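(* Let $\boldsymbol g=(g_1,\dots,g_m)$ be Hermitian operators and $\boldsymbol L=(L_1,\dots,L_r)$ jump operators on a finite-dimensional Hilbert space, and let $\boldsymbol\alpha\in\mathbb R^m$, $\boldsymbol\alpha\neq0$. Write $G(\boldsymbol\beta)=\sum_j\beta_jg_j$, let $\mathcal S_L$ be the Lindblad span, and set $$\zeta^*:=\min_{\boldsymbol\beta\in\mathbb R^m:\,\boldsymbol\alpha\cdot\boldsymbol\beta=1}\ \min_{S\in\mathcal S_L}\|G(\boldsymbol\beta)-S\|_s .$$ Then $\zeta^*$ equals the optimal value of the dual semidefinite program $$\max_{\zeta,\rho_0,\rho_1}\ \zeta$$ subject to $$\mathrm{Tr}[(\rho_0-\rho_1)g_j]=\zeta\alpha_j\ (j=1,\dots,m),\quad \mathrm{Tr}[(\rho_0-\rho_1)S]=0\ \ \forall S\in\mathcal S_L,\quad \rho_0,\rho_1\succeq0,\quad \mathrm{Tr}(\rho_0)=\mathrm{Tr}(\rho_1)=1 ,$$ where $\zeta\in\mathbb R$. Consequently, the optimal quantum Fisher information bound $F_{q,\mathrm{opt}}$ for $q=\boldsymbol\alpha\cdot\boldsymbol\theta$ is $$F_{q,\mathrm{opt}}=t^2(\zeta^* )^2$$ whenever the functional HNLS condition holds. If the functional HNLS condition fails, then $\zeta^*=0$.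
   Context: $\|O\|_s$ denotes the spectral range (seminorm) of a Hermitian operator $O$: its largest eigenvalue minus its smallest eigenvalue. Lindblad span: $\mathcal S_L=\mathrm{span}_{\mathbb R}\{I,\,L_a^{\rm H},\,iL_a^{\rm AH},\,(L_a^\dagger L_b)^{\rm H},\,i(L_a^\dagger L_b)^{\rm AH}\}_{a,b}$ with $O^{\rm H}=(O+O^\dagger)/2$, $O^{\rm AH}=(O-O^\dagger)/2$. Functional HNLS (Hamiltonian-not-in-Lindblad-span) condition: let $g_{j,\perp}$ be the projection of $g_j$ onto the orthogonal complement of $\mathcal S_L$ and $G_\perp(\boldsymbol v)=\sum_jv_jg_{j,\perp}$; the condition is $\ker(G_\perp)\subseteq\ker(\boldsymbol\alpha^T)$, i.e. $G_\perp(\boldsymbol v)=0$ implies $\boldsymbol\alpha\cdot\boldsymbol v=0$. Model: a system, possibly coupled to noiseless ancillas, evolves for a total sensing time $t$ by $\frac{d\rho}{ds}=-i[H_0+H_c(s),\rho]+\sum_{a=1}^r\left(L_a\rho L_a^\dagger-\tfrac12\{L_a^\dagger L_a,\rho\}\right)$, $s\in[0,t]$, with $H_0=\sum_{j=1}^m\theta_jg_j$, unknown $\boldsymbol\theta\in\mathbb R^m$, and $H_c(s)$ a $\boldsymbol\theta$-independent control Hamiltonian on the system and ancillas. The goal is to estimate $q=\boldsymbol\alpha\cdot\boldsymbol\theta$. Definition of $F_{q,\mathrm{opt}}$: for each $\boldsymbol\beta$ with $\boldsymbol\alpha\cdot\boldsymbol\beta=1$, giving away all nuisance parameters leaves a single-parameter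 problem in which $q$ couples to the generator $G(\boldsymbol\beta)$. $F_{q,\mathrm{opt}}$ is the minimum, over all $\boldsymbol\beta$ with $\boldsymbol\alpha\cdot\boldsymbol\beta=1$, of the single-parameter upper bound on the quantum Fisher information with generator $G(\boldsymbol\beta)$; it upper-bounds the quantum Fisher information $F_q$ about $q$ of any protocol. The single-parameter bound used here is the known asymptotic (large $t$) one for Markovian noise, with value $t^2\min_{S\in\mathcal S_L}\|G(\boldsymbol\beta)-S\|_s^2$, so that $\lim_{t\to\infty}F_q/t^2\le(\zeta^* )^2$. *)

(* Defs.v *)
From HB Require Import structures.
From mathcomp Require Import all_boot all_order all_algebra.
From mathcomp Require Import complex.
From mathcomp Require Import boolp classical_sets reals.

Set Implicit Arguments.
Unset Strict Implicit.
Unset Printing Implicit Defensive.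

Import Order.TTheory GRing.Theory Num.Theory.

Local Open Scope ring_scope.
Local Open Scope complex_scope.
Local Open Scope sesquilinear_scope.
Local Open Scope classical_set_scope.

(* Operators on C^d are matrices over R[i], with adjoint A^t*; Hermitian means
   A \is hermsymmx. Real scalars act on them through x%:C. *)

Section Extrema.
Variable R : realType.

Definition is_min (A : set R) (x : R) : Prop := A x /\ lbound A x.
Definition is_max (A : set R) (x : R) : Prop := A x /\ ubound A x.

Lemma is_min_inf (A : set R) (x : R) : is_min A x -> inf A = x.
Proof.
move=> [Ax lAx]; apply/eqP; rewrite eq_le; apply/andP; split.
  by apply: ge_inf => //; exists x.
by apply: lb_le_inf => //; exists x.
Qed.

End Extrema.

Section Operators.
Variables (R : realType) (d : nat).
Local Notation M := 'M[R[i]]_d.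

Definition hpart (A : M) : M := (2%:R)^-1 *: (A + A^t*).
Definition ahpart (A : M) : M := (2%:R)^-1 *: (A - A^t*).

Definition psd (A : M) : Prop :=
  A \is hermsymmx /\ forall v : 'rV[R[i]]_d, 0 <= (v *m A *m v^t*) 0 0.

(* For Hermitian A with d > 0 all eigenvalues are real, and the sup and inf of
   this set are attained: see real_eigenvalues_extrema. *)
Definition real_eigenvalues (A : M) : set R := [set x | eigenvalue A x%:C].

Definition spectral_range (A : M) : R :=
  sup (real_eigenvalues A) - inf (real_eigenvalues A).

Definition real_span (B : seq M) : set M :=
  [set S | exists c : 'I_(size B) -> R, S = \sum_(k < size B) (c k)%:C *: B`_k].

(* Orthogonality is with respect to the Hilbert-Schmidt inner product
   Tr (A^t* B) = Tr (A B) on the real vector space of Hermitian operators. *)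
Definition herm_orth (V : set M) : set M :=
  [set P | P \is hermsymmx /\ forall S, V S -> \tr (P *m S) = 0].

(* The projection of X onto the orthogonal complement of V: the P
   orthogonal to V such that X - P is in V. For V the real span of Hermitian
   operators and X Hermitian it exists and is unique: see perp_partP and
   perp_unique. *)
Definition perp_part (V : set M) (X : M) : M :=
  xget 0 [set P | herm_orth V P /\ V (X - P)].

End Operators.

Section Lindblad.
Variables (R : realType) (d r : nat).
Local Notation M := 'M[R[i]]_d.
Implicit Types L : 'I_r -> M.

Definition lindblad_generators L : seq M :=
  1%:M
  :: [seq hpart (L a) | a : 'I_r]
  ++ [seq 'i *: ahpart (L a) | a : 'I_r]
  ++ [seq hpart ((L ab.1)^t* *m L ab.2) | ab : 'I_r * 'I_r]
  ++ [seq 'i *: ahpart ((L ab.1)^t* *m L ab.2) | ab : 'I_r * 'I_r].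

Definition lindblad_span L : set M := real_span (lindblad_generators L).

Definition lindblad_dist L (X : M) : R :=
  inf [set spectral_range (X - S) | S in lindblad_span L].

(* The asymptotic (large t) Markovian-noise upper bound on the quantum Fisher information, at sensing
   time t, about a single parameter coupled to the generator X. *)
Definition qfi_bound L (t : R) (X : M) : R := t ^+ 2 * lindblad_dist L X ^+ 2.

End Lindblad.

Section FunctionalEstimation.
Variables (R : realType) (d m r : nat).
Local Notation M := 'M[R[i]]_d.
Implicit Types (g : 'I_m -> M) (L : 'I_r -> M) (alpha beta : 'rV[R]_m).

Definition rdot alpha beta : R := \sum_j alpha 0 j * beta 0 j.

Definition combination g beta : M := \sum_j (beta 0 j)%:C *: g j.

Definition normalized alpha : set 'rV[R]_m := [set beta | rdot alpha beta = 1].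

Definition zeta_star g L alpha : R :=
  inf [set lindblad_dist L (combination g beta) | beta in normalized alpha].

Definition F_opt g L alpha (t : R) : R :=
  inf [set qfi_bound L t (combination g beta) | beta in normalized alpha].

Definition functional_HNLS g L alpha : Prop :=
  forall v : 'rV[R]_m,
    combination (fun j => perp_part (lindblad_span L) (g j)) v = 0 ->
    rdot alpha v = 0.

Definition dual_feasible g L alpha (zeta : R) (rho0 rho1 : M) : Prop :=
  [/\ forall j, \tr ((rho0 - rho1) *m g j) = (zeta * alpha 0 j)%:C,
      forall S, lindblad_span L S -> \tr ((rho0 - rho1) *m S) = 0,
      psd rho0 /\ psd rho1
    & \tr rho0 = 1 /\ \tr rho1 = 1].

Definition dual_values g L alpha : set R :=
  [set zeta | exists rho0 rho1, dual_feasible g L alpha zeta rho0 rho1].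

End FunctionalEstimation.

Section HermitianFacts.
Variables (R : realType) (d : nat).
Local Notation M := 'M[R[i]]_d.
Implicit Types (A P X S : M) (B : seq M).

Lemma hermsymmxE A : (A \is hermsymmx) = (A == A^t*).
Proof. by rewrite is_hermitianmxE expr0 scale1r. Qed.

Lemma adjD A S : (A + S)^t* = A^t* + S^t*.
Proof. by rewrite linearD /= map_mxD. Qed.

Lemma adjZ (x : R[i]) A : (x *: A)^t* = x^* *: A^t*.
Proof. by rewrite linearZ /= map_mxZ. Qed.

Lemma conjC_real (x : R) : Num.conj (x%:C) = x%:C.
Proof. exact: conjc_real. Qed.

Lemma hermD A S : A \is hermsymmx -> S \is hermsymmx -> A + S \is hermsymmx.
Proof. by rewrite !hermsymmxE adjD => /eqP <- /eqP <-. Qed.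

Lemma hermZ (x : R) A : A \is hermsymmx -> x%:C *: A \is hermsymmx.
Proof. by rewrite !hermsymmxE adjZ conjC_real => /eqP <-. Qed.

Lemma hermN A : A \is hermsymmx -> - A \is hermsymmx.
Proof. by rewrite -scaleN1r -[-1](rmorphN1 (real_complex R)); apply: hermZ. Qed.

Lemma herm0 : (0 : M) \is hermsymmx.
Proof. by rewrite hermsymmxE linear0 map_mx0. Qed.

Lemma mxtrace_adj A : \tr (A^t*) = (\tr A)^*.
Proof. by rewrite /mxtrace rmorph_sum; apply: eq_bigr => k _; rewrite !mxE. Qed.

Lemma herm_trace_real A S : A \is hermsymmx -> S \is hermsymmx ->
  \tr (A *m S) = (complex.Re (\tr (A *m S)))%:C.
Proof.
rewrite !hermsymmxE => /eqP hA /eqP hS; rewrite RRe_real //.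
apply/CrealP; rewrite -[LHS]mxtrace_adj [RHS]mxtrace_mulC.
by rewrite trmx_mul map_mxM /= -hA -hS.
Qed.

Lemma herm_trace_sqr_eq0 A : A \is hermsymmx -> \tr (A *m A) = 0 -> A = 0.
Proof.
rewrite hermsymmxE => /eqP hA; rewrite {2}hA /mxtrace => /eqP.
have sqE i : (A *m A^t*) i i = \sum_j `|A i j| ^+ 2.
  by rewrite !mxE; apply: eq_bigr => j _; rewrite !mxE -normCK.
rewrite psumr_eq0 => [/allP A0|i _]; last first.
  by rewrite sqE; apply: sumr_ge0 => j _; rewrite exprn_ge0.
apply/matrixP => i j; rewrite mxE; have := A0 i (mem_index_enum i).
rewrite /= sqE psumr_eq0 => [/allP/(_ j (mem_index_enum j))|k _]; last first.
  by rewrite exprn_ge0.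
by rewrite /= sqrf_eq0 normr_eq0 => /eqP.
Qed.

Lemma real_span_nil S : real_span [::] S <-> S = 0.
Proof.
split=> [[c ->]|->]; first by rewrite big_ord0.
by exists (fun=> 0); rewrite big_ord0.
Qed.

Lemma real_span_cons b B S :
  real_span (b :: B) S <-> exists x : R, real_span B (S - x%:C *: b).
Proof.
split=> [[c ->]|[x [c cE]]].
  exists (c ord0), (fun k => c (lift ord0 k)).
  by rewrite big_ord_recl /= addrC addKr.
exists (fun k => if unlift ord0 k is Some k' then c k' else x).
rewrite big_ord_recl /= unlift_none; apply/eqP.
rewrite addrC -subr_eq cE; apply/eqP.
by apply: eq_bigr => k _; rewrite liftK.
Qed.

Lemma real_span0 B : real_span B 0.
Proof. by exists (fun=> 0); rewrite big1 // => k _; rewrite scale0r. Qed.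

Lemma real_spanD B S T : real_span B S -> real_span B T -> real_span B (S + T).
Proof.
move=> [c ->] [e ->]; exists (fun k => c k + e k); rewrite -big_split /=.
by apply: eq_bigr => k _; rewrite rmorphD scalerDl.
Qed.

Lemma real_spanZ B (x : R) S : real_span B S -> real_span B (x%:C *: S).
Proof.
move=> [c ->]; exists (fun k => x * c k); rewrite scaler_sumr.
by apply: eq_bigr => k _; rewrite rmorphM scalerA.
Qed.

Lemma real_spanN B S : real_span B S -> real_span B (- S).
Proof.
by rewrite -scaleN1r -[-1](rmorphN1 (real_complex R)); apply: real_spanZ.
Qed.

Lemma real_span_herm B S :
  all (fun A => A \is hermsymmx) B -> real_span B S -> S \is hermsymmx.
Proof.
elim: B S => [|b B IH] S /=; first by move=> _ /real_span_nil ->; exact: herm0.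
case/andP=> hb hB /real_span_cons [x /(IH _ hB) h].
by rewrite -[S](subrK (x%:C *: b)) hermD // hermZ.
Qed.

Lemma perp_exists B X :
  all (fun A => A \is hermsymmx) B -> X \is hermsymmx ->
  exists P, herm_orth (real_span B) P /\ real_span B (X - P).
Proof.
elim: B X => [|b B IH] X /=.
  move=> _ hX; exists X; rewrite subrr; split; last exact: real_span0.
  by split=> // S /real_span_nil ->; rewrite mulmx0 mxtrace0.
case/andP=> hb hB hX.
have [P [[hP oP] sP]] := IH X hB hX; have [Q [[hQ oQ] sQ]] := IH b hB hb.
have oQb : \tr (Q *m b) = \tr (Q *m Q).
  by rewrite -{1}[b](subrK Q) mulmxDr mxtraceD (oQ _ sQ) add0r.
pose n := complex.Re (\tr (Q *m Q)); pose t := complex.Re (\tr (P *m b)) / n.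
exists (P - t%:C *: Q); split; first split.
- by rewrite hermD ?hermN ?hermZ.
- move=> S /real_span_cons [x sS]; rewrite -[S](subrK (x%:C *: b)).
  have trE T : \tr ((P - t%:C *: Q) *m T) = \tr (P *m T) - t%:C * \tr (Q *m T).
    by rewrite mulmxBl -scalemxAl -[- (_ *: _)]scaleN1r mxtraceD !mxtraceZ mulN1r.
  rewrite mulmxDr mxtraceD trE -scalemxAr mxtraceZ trE.
  rewrite (oP _ sS) (oQ _ sS) oQb mulr0 subrr add0r.
  rewrite (herm_trace_real hP hb) (herm_trace_real hQ hQ) -/n.
  have [n0|nN0] := eqVneq n 0; last first.
    by rewrite -rmorphM /t divfK // subrr mulr0.
  have Q0 : Q = 0.
    by apply: herm_trace_sqr_eq0 => //; rewrite herm_trace_real // -/n n0.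
  rewrite n0 mulr0 subr0 -(herm_trace_real hP hb).
  by move: sQ; rewrite Q0 subr0 => /oP ->; rewrite mulr0.
apply/real_span_cons; exists t.
have -> : X - (P - t%:C *: Q) - t%:C *: b = (X - P) - t%:C *: (b - Q).
  by rewrite scalerBr !opprB addrA -!addrA; congr (_ + _); rewrite addrCA.
by apply: real_spanD => //; apply/real_spanN/real_spanZ.
Qed.

Lemma perp_unique B X P P' :
  herm_orth (real_span B) P /\ real_span B (X - P) ->
  herm_orth (real_span B) P' /\ real_span B (X - P') -> P = P'.
Proof.
move=> [[hP oP] sP] [[hP' oP'] sP']; apply/eqP; rewrite -subr_eq0; apply/eqP.
have s : real_span B (P - P').
  have -> : P - P' = (X - P') - (X - P) by rewrite opprB [RHS]addrC addrA subrK.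
  by apply/real_spanD/real_spanN.
apply: herm_trace_sqr_eq0; first by rewrite hermD ?hermN.
by rewrite mulmxBl raddfB /= oP // oP' // subrr.
Qed.

Lemma perp_partP B X :
  all (fun A => A \is hermsymmx) B -> X \is hermsymmx ->
  herm_orth (real_span B) (perp_part (real_span B) X)
  /\ real_span B (X - perp_part (real_span B) X).
Proof. by move=> hB hX; exact: xgetPex (perp_exists hB hX). Qed.

End HermitianFacts.

Lemma lindblad_generators_herm (R : realType) (d r : nat)
    (L : 'I_r -> 'M[R[i]]_d) :
  all (fun A => A \is hermsymmx) (lindblad_generators L).
Proof.
have hH (A : 'M[R[i]]_d) : hpart A \is hermsymmx.
  rewrite hermsymmxE /hpart adjZ adjD trmxCK fmorphV rmorph_nat.
  by rewrite [A^t* + A]addrC.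
have hA (A : 'M[R[i]]_d) : 'i *: ahpart A \is hermsymmx.
  rewrite hermsymmxE /ahpart !adjZ -scaleN1r adjD adjZ trmxCK fmorphV rmorph_nat.
  by rewrite conjCi rmorphN1 !scaleN1r scaleNr -!scalerN opprB.
rewrite /= hermsymmxE trmx1 map_mx1 eqxx /= !all_cat; do 4?[apply/andP; split];
  by apply/allP => _ /mapP [x _ ->]; rewrite ?hH ?hA.
Qed.

Section Eigenvalues.
Variables (R : realType) (d : nat).
Local Notation M := 'M[R[i]]_d.+1.

Lemma is_max_sup (A : set R) (x : R) : is_max A x -> sup A = x.
Proof.
move=> [Ax uAx]; apply/eqP; rewrite eq_le; apply/andP; split.
  by apply: ge_sup => //; exists x.
by apply: ub_le_sup => //; exists x.
Qed.

Lemma eigenvalue_herm_real (A : M) (a : R[i]) :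
  A \is hermsymmx -> eigenvalue A a -> a = (complex.Re a)%:C.
Proof.
rewrite hermsymmxE => /eqP hA /eigenvalueP [v vA v0]; rewrite RRe_real //.
have vv : (v *m v^t*) 0 0 != 0.
  by rewrite -dotmxE dnorm_eq0.
have E : v *m A *m v^t* = a *: (v *m v^t*) by rewrite vA -scalemxAl.
have F : (v *m A *m v^t*)^t* = v *m A *m v^t*.
  by rewrite !trmx_mul !map_mxM trmxCK -hA mulmxA.
have G : (v *m v^t*)^t* = v *m v^t* by rewrite !trmx_mul !map_mxM trmxCK.
move: F; rewrite E adjZ G => /matrixP /(_ 0 0); rewrite !mxE => F.
apply/CrealP; apply: (mulIf vv); rewrite !mxE; exact: F.
Qed.

Lemma real_eigenvalues_seq (A : M) : A \is hermsymmx ->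
  exists2 s : seq R, s != [::] & forall x, real_eigenvalues A x <-> x \in s.
Proof.
move=> hA; have [rs pE] := closed_field_poly_normal (char_poly A).
have rsE a : eigenvalue A a = (a \in rs).
  rewrite eigenvalue_root_char pE (eqP (char_poly_monic A)) scale1r.
  by rewrite root_prod_XsubC.
exists [seq complex.Re a | a <- rs].
  have [a] := eigenvalue_closed A (ltn0Sn d).
  by rewrite rsE; case: (rs).
move=> x; rewrite /real_eigenvalues /= rsE; split=> [xrs|/mapP [a ars ->]].
  by apply/mapP; exists x%:C.
by rewrite -(eigenvalue_herm_real hA) // rsE.
Qed.

Lemma seq_extrema (s : seq R) : s != [::] ->
  (exists x, is_max [set` s] x) /\ (exists x, is_min [set` s] x).
Proof.
case: s => // x s _; elim: s x => [|y s IH] x.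
  by split; exists x; split=> [|z] /=; rewrite mem_seq1 // => /eqP ->.
have [[a [/= ay ua]] [b [/= bs lb]]] := IH y.
split.
  exists (Order.max x a); split=> [|z] /=; rewrite in_cons.
    by rewrite maxEle; case: ifP => _; rewrite ?ay ?eqxx ?orbT.
  by case/predU1P=> [->|/ua za]; rewrite le_max ?lexx ?za ?orbT.
exists (Order.min x b); split=> [|z] /=; rewrite in_cons.
  by rewrite minEle; case: ifP => _; rewrite ?bs ?eqxx ?orbT.
by case/predU1P=> [->|/lb za]; rewrite ge_min ?lexx ?za ?orbT.
Qed.

Lemma real_eigenvalues_extrema (A : M) : A \is hermsymmx ->
  is_max (real_eigenvalues A) (sup (real_eigenvalues A))
  /\ is_min (real_eigenvalues A) (inf (real_eigenvalues A)).
Proof.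
case/real_eigenvalues_seq=> s /seq_extrema [[x mx] [y my]] sE.
have -> : real_eigenvalues A = [set` s] by apply/seteqP; split=> z /sE.
by rewrite (is_max_sup mx) (is_min_inf my).
Qed.

End Eigenvalues.

(* Main.v *)
Require Import Defs.
From HB Require Import structures.
From mathcomp Require Import all_boot all_order all_algebra.
From mathcomp Require Import complex ring lra.
From mathcomp Require Import boolp classical_sets reals.
From mathcomp Require Import topology normedtype derive.

Set Implicit Arguments.
Unset Strict Implicit.
Unset Printing Implicit Defensive.

Import Order.TTheory GRing.Theory Num.Theory.
Import numFieldNormedType.Exports.

Local Open Scope ring_scope.
Local Open Scope complex_scope.
Local Open Scope sesquilinear_scope.
Local Open Scope classical_set_scope.

(* The spectral range is a seminorm on Hermitian operators and equals the support
   function of the differences rho0 - rho1 of density operators. Fixing one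
   normalized beta0, the operators G(beta) - S fill the affine space
   G(beta0) + W, where W is spanned by the Lindblad span and the
   g_j - alpha_j G(beta0); so zeta* is the distance from G(beta0) to the
   finite-dimensional subspace W. The distance is attained, one generator of W at
   a time, and Hahn-Banach gives a functional dominated by the seminorm, vanishing
   on W and norming G(beta0). It is the trace against some rho0 - rho1, and its
   vanishing on W is exactly the two families of linear dual constraints. *)

(** * Sublinear functionals and seminorms on real vector spaces *)

Section Sublinear.
Variables (R : realType) (E : lmodType R).
Implicit Types (p q : E -> R) (x y z e : E).

Definition sublinear q :=
  (forall x y, q (x + y) <= q x + q y)
  /\ (forall (a : R) x, 0 <= a -> q (a *: x) = a * q x).

Definition seminorm p := sublinear p /\ (forall x, p (- x) = p x).

(** The inequality for the inverse scalar gives the reverse one; at scalar 0, subadditivity supplies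
    [0 <= q 0]. *)
Lemma sublinear_of_le q :
  (forall x y, q (x + y) <= q x + q y) ->
  (forall (a : R) x, 0 <= a -> q (a *: x) <= a * q x) -> sublinear q.
Proof.
move=> qD qZ; split=> // a x; rewrite le_eqVlt => /predU1P[<-|a0].
  rewrite scale0r mul0r; apply/eqP; rewrite eq_le.
  have := qZ 0 0 (lexx 0); rewrite scale0r mul0r => -> /=.
  by have := qD 0 0; rewrite addr0 -lerBlDl subrr.
apply/eqP; rewrite eq_le qZ 1?(ltW a0) //=.
have := qZ a^-1 (a *: x); rewrite invr_ge0 (ltW a0) => /(_ isT).
by rewrite scalerA mulVf ?gt_eqF // scale1r ler_pdivlMl.
Qed.

Lemma sublinear0 q : sublinear q -> q 0 = 0.
Proof. by move=> [_ qZ]; rewrite -(scale0r 0) qZ // mul0r. Qed.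

Lemma sublinearN q x : sublinear q -> - q (- x) <= q x.
Proof.
move=> qs; have := qs.1 x (- x); rewrite subrr sublinear0 // => h; lra.
Qed.

Lemma seminormZ p a x : seminorm p -> p (a *: x) = `|a| * p x.
Proof.
move=> [[_ pZ] pN]; have [a0|a0] := ger0P a; first exact: pZ.
by rewrite -pZ ?oppr_ge0 ?ltW // scaleNr pN.
Qed.

Lemma seminorm_ge0 p x : seminorm p -> 0 <= p x.
Proof. by move=> [ps pN]; have := sublinearN x ps; rewrite pN => ?; lra. Qed.

Lemma seminorm_le_add p x y : seminorm p -> p x <= p y + p (x - y).
Proof. by move=> [[pD _] _]; have := pD y (x - y); rewrite addrC subrK. Qed.

(** The function of [t] is Lipschitz with constant [p b]: it is constant if [p b = 0], and otherwise
    it is continuous and grows at infinity, so a compact interval suffices. *)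
Lemma seminorm_line_min p b x : seminorm p ->
  exists t, forall s, p (x - t *: b) <= p (x - s *: b).
Proof.
move=> ps; have b0 := seminorm_ge0 b ps; have x0 := seminorm_ge0 x ps.
have lip t s : p (x - t *: b) <= p (x - s *: b) + `|s - t| * p b.
  rewrite -seminormZ // scalerBl.
  have -> : s *: b - t *: b = (x - t *: b) - (x - s *: b).
    by rewrite opprB [RHS]addrC addrA subrK.
  exact: seminorm_le_add.
move: b0; rewrite le_eqVlt => /predU1P[b0|b0].
  by exists 0 => s; have := lip 0 s; rewrite -b0 mulr0 addr0.
(* For [|s| > T] the triangle inequality gives [p (x - s *: b) >= |s| * p b - p x > p x], and [p x]
   is the value at 0; so a minimum over [[-T, T]] is global. *)
pose T := 2 * p x / p b.
have T0 : 0 <= T by rewrite divr_ge0 ?mulr_ge0 // ltW.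
have cf : continuous (fun t : R => p (x - t *: b)).
  move=> t; apply/cvgrPdist_lt => e e0; near=> s.
  have st : `|t - s| * p b < e.
    rewrite -ltr_pdivlMr //; near: s.
    by apply: (nbhsx_ballx t); rewrite divr_gt0.
  have := lip t s; have := lip s t; rewrite [`|s - t|]distrC => h1 h2.
  by rewrite ltr_norml; apply/andP; split; lra.
have [||t tT tmin] := @EVT_min R (fun t => p (x - t *: b)) (- T) T.
- lra.
- exact: continuous_subspaceT.
exists t => s; have [sT|] := boolP (s \in `[- T, T]%R); first exact: tmin.
rewrite in_itv /= -ler_norml -ltNge => sT.
apply: (@le_trans _ _ (p x)).
  by have := tmin 0; rewrite in_itv /= oppr_le0 T0 scale0r subr0; apply.
have := seminorm_le_add (- (s *: b)) (- x) ps.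
rewrite opprK addrC [- _ + x]addrC !ps.2 seminormZ // => h.
by move: sT; rewrite ltr_pdivrMr // => sT; lra.
Unshelve. all: by end_near.
Qed.

(** This is the quotient seminorm by the line of [b]. Since minimizers exist, each seminorm law
    follows by combining or rescaling them. *)
Lemma seminorm_quotient_line p b : seminorm p ->
  exists q, [/\ seminorm q, forall x, exists t, q x = p (x - t *: b)
              & forall x t, q x <= p (x - t *: b)].
Proof.
move=> ps; have [t tP] := choice (fun x => seminorm_line_min b x ps).
have [[pD pZ] pN] := ps.
exists (fun x => p (x - t x *: b)); split; [split | by move=> x; exists (t x) | by []].
  apply: sublinear_of_le => [x y|a x a0].
    apply: le_trans (tP _ (t x + t y)) _.
    by rewrite scalerDl opprD addrACA.
  apply: le_trans (tP _ (a * t x)) _.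
  by rewrite -scalerA -scalerBr pZ.
have le x : p (- x - t (- x) *: b) <= p (x - t x *: b).
  apply: le_trans (tP _ (- t x)) _.
  by rewrite -[leRHS]pN opprB scaleNr opprK addrC.
by move=> x; apply/le_anti/andP; split=> //=; have := le (- x); rewrite opprK.
Qed.

(* The sublinear functional [x |-> inf_(t >= 0) (q (x + t e) - t q e)] lies
   below [q] and is linear on the line spanned by [e]. *)
Lemma sublinear_straighten q e : sublinear q ->
  exists q', [/\ sublinear q', forall x, q' x <= q x & q' (- e) <= - q e].
Proof.
move=> qs; have [qD qZ] := qs.
pose A x := [set q (x + t *: e) - t * q e | t in [set t : R | 0 <= t]].
(* This bound is what makes the infimum finite. *)
have lbA x : lbound (A x) (- q (- x)).
  move=> _ [t /= t0 <-]; rewrite -qZ //.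
  by have := qD (x + t *: e) (- x); rewrite addrC addrA addNr add0r => ?; lra.
have infA x t : 0 <= t -> inf (A x) <= q (x + t *: e) - t * q e.
  by move=> t0; apply: ge_inf; [exists (- q (- x)) | exists t].
have leinf x c : (forall t, 0 <= t -> c <= q (x + t *: e) - t * q e) ->
    c <= inf (A x).
  move=> h; apply: lb_le_inf; first by exists (q (x + 0 *: e) - 0 * q e), 0 => /=.
  by move=> _ [t t0 <-]; exact: h.
exists (fun x => inf (A x)); split.
- apply: sublinear_of_le => [x y|a x].
    rewrite -lerBlDr; apply: (leinf) => t t0; rewrite lerBlDr -lerBlDl.
    apply: (leinf) => s s0; have := infA (x + y) (t + s) (addr_ge0 t0 s0).
    have := qD (x + t *: e) (y + s *: e).
    by rewrite addrACA -scalerDl mulrDl => ? ?; lra.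
  rewrite le_eqVlt => /predU1P[<-|a0].
    rewrite scale0r mul0r; apply: le_trans (infA 0 0 (lexx 0)) _.
    by rewrite scale0r addr0 sublinear0 // mul0r subr0.
  rewrite -ler_pdivrMl //; apply: (leinf) => t t0.
  rewrite ler_pdivrMl //; apply: le_trans (infA _ (a * t) _) _.
    by rewrite mulr_ge0 // ltW.
  by rewrite -scalerA -scalerDr (qZ _ _ (ltW a0)) mulrBr mulrA.
- by move=> x; have := infA x 0 (lexx 0); rewrite scale0r addr0 mul0r subr0.
(* At [t = 1] the argument [- e + e] vanishes and only [- q e] remains. *)
- have := infA (- e) 1 ler01.
  by rewrite scale1r addNr sublinear0 // mul1r sub0r.
Qed.

End Sublinear.

(** * Distance to a subspace and Hahn-Banach in finite dimension *)

Section FiniteDimension.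
Variables (R : realType) (E : vectType R).
Implicit Types (p q : E -> R) (x y z e : E).

(** Quotienting by one generator at a time keeps the infimum attained at every stage, so no
    compactness in several dimensions is involved. *)
Lemma seminorm_quotient p (B : seq E) : seminorm p ->
  exists q, [/\ seminorm q, forall x, exists2 y, y \in <<B>>%VS & q x = p (x - y)
              & forall x y, y \in <<B>>%VS -> q x <= p (x - y)].
Proof.
elim: B p => [|b B IH] p ps.
  exists p; split=> // [x|x y]; first by exists 0; rewrite ?mem0v ?subr0.
  by rewrite span_nil memv0 => /eqP ->; rewrite subr0.
have [p' [p's p'E p'le]] := seminorm_quotient_line b ps.
have [q [qs qE qle]] := IH p' p's; exists q; split=> // [x|x z].
  have [y yB ->] := qE x; have [t ->] := p'E (x - y).
  exists (t *: b + y); last by rewrite opprD [- _ - y]addrC addrA.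
  by rewrite span_cons memv_add // memvZ // memv_line.
rewrite span_cons => /memv_addP[_ /vlineP[t ->] [y yB ->]].
apply: le_trans (qle x y yB) _.
by rewrite opprD [- _ - y]addrC addrA; exact: p'le.
Qed.

(** Straightening along [b] survives any further decrease:
    [q' (- b) <= q1 (- b) <= - q b <= - q' b], and sublinearity gives the converse. *)
Lemma sublinear_linear_on (B : seq E) q : sublinear q ->
  exists q', [/\ sublinear q', forall x, q' x <= q x
               & forall b, b \in B -> q' (- b) = - q' b].
Proof.
elim: B q => [|b B IH] q qs; first by exists q.
have [q1 [q1s q1q q1b]] := sublinear_straighten b qs.
have [q' [q's q'q1 q'B]] := IH q1 q1s.
exists q'; split=> // [x|c]; first exact: le_trans (q'q1 x) (q1q x).
rewrite in_cons => /predU1P[->|/q'B//].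
apply/eqP; rewrite eq_le; apply/andP; split.
  by have := q'q1 (- b); have := q'q1 b; have := q1q b; lra.
by have := sublinearN b q's; lra.
Qed.

(** Straightening along [x0] comes first, so that [f (- x0) <= - q x0] forces [f x0 = q x0];
    straightening along a basis then yields linearity. *)
Lemma hahn_banach q x0 : sublinear q ->
  exists f : {linear E -> R^o}, (forall x, f x <= q x) /\ f x0 = q x0.
Proof.
move=> qs; have [q1 [q1s q1q q1x0]] := sublinear_straighten x0 qs.
have [f [[fD fZ] fq1 fB]] := sublinear_linear_on (vbasis fullv) q1s.
have fs : sublinear f by [].
(* Oddness passes from the basis to sums, because subadditivity at [y, z] and at [- y, - z] squeezes
   [f (- (y + z))]. *)
have fN x : f (- x) = - f x.
  rewrite (coord_vbasis (memvf x)).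
  apply: (big_ind (fun x => f (- x) = - f x)).
  - by rewrite oppr0 sublinear0 // oppr0.
  - move=> y z fy fz; have := fD y z; have := fD (- y) (- z).
    have := sublinearN (y + z) fs; rewrite opprD fy fz => ? ? ?; lra.
  move=> i _; set b := _`_i; have bE : f (- b) = - f b by rewrite fB ?mem_nth ?size_tuple.
  move: (coord _ _ _) => a; have [a0|/ltW a0] := leP 0 a.
    by rewrite -scalerN !fZ // bE mulrN.
  rewrite -[a]opprK [- - a *: _]scaleNr opprK -scalerN !fZ ?oppr_ge0 //.
  by rewrite bE mulrN opprK.
(* An odd subadditive function is also superadditive, hence additive. *)
have flin : linear (f : E -> R^o).
  move=> a x y; have E1 : f (a *: x + y) = f (a *: x) + f y.
    apply/eqP; rewrite eq_le fD /=.
    by have := fD (- (a *: x)) (- y); rewrite -opprD !fN => ?; lra.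
  rewrite E1; congr (_ + _); have [a0|/ltW a0] := leP 0 a; first exact: fZ.
  by rewrite -[a]opprK scaleNr fN fZ ?oppr_ge0 // -mulNr.
pose F := HB.pack f (GRing.isLinear.Build R E R^o *:%R f flin) : {linear E -> R^o}.
exists F; split=> [x|]; first exact: le_trans (fq1 x) (q1q x).
change (f x0 = q x0); apply/eqP; rewrite eq_le (le_trans (fq1 _) (q1q _)) /=.
have := fq1 (- x0); rewrite fN => ?; lra.
Qed.

(** Hahn-Banach is applied to the quotient seminorm rather than to [p]: it is at most 0 on the span,
    which makes [f] vanish there. *)
Theorem seminorm_duality p (B : seq E) x : seminorm p ->
  exists y, [/\ y \in <<B>>%VS, forall z, z \in <<B>>%VS -> p (x - y) <= p (x - z)
    & exists f : {linear E -> R^o}, [/\ forall z, f z <= p z,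
        forall z, z \in <<B>>%VS -> f z = 0 & f x = p (x - y)]].
Proof.
move=> ps; have [q [qs qE qle]] := seminorm_quotient B ps.
have [y yB qx] := qE x; exists y; split=> // [z zB|]; first by rewrite -qx qle.
have [f [fq fx]] := hahn_banach x qs.1; exists f; split=> [z|z zB|].
- by apply: le_trans (fq z) _; rewrite -[z in p z]subr0 qle ?mem0v.
- have q0 w : w \in <<B>>%VS -> q w <= 0.
    by move=> wB; apply: le_trans (qle w w wB) _; rewrite subrr (sublinear0 ps.1).
  apply/eqP; rewrite eq_le (le_trans (fq z)) ?q0 //= -oppr_le0 -linearN.
  by rewrite (le_trans (fq _)) ?q0 ?memvN.
- by rewrite fx.
Qed.

End FiniteDimension.

(** * Spectral decomposition of Hermitian matrices *)

Section SpectralMatrices.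
Variables (R : realType) (n : nat).
Local Notation C := R[i].
Local Notation M := 'M[C]_n.
Implicit Types (P X Y : M) (mu nu : 'rV[R]_n) (v : 'rV[C]_n).

(** Eigenvectors are row vectors, so for unitary [P] they are the rows of [P]; the eigenvalues are
    kept as real numbers. *)
Definition spectral_mx P mu : M :=
  P^t* *m diag_mx (map_mx (real_complex R) mu) *m P.

Lemma spectral_mxB P mu nu :
  spectral_mx P mu - spectral_mx P nu = spectral_mx P (mu - nu).
Proof. by rewrite /spectral_mx map_mxB linearB mulmxBr mulmxBl. Qed.

Lemma spectral_mxN P mu : - spectral_mx P mu = spectral_mx P (- mu).
Proof. by rewrite /spectral_mx map_mxN linearN mulmxN mulNmx. Qed.

Lemma unitarymxKC P : P \is unitarymx -> P^t* *m P = 1%:M.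
Proof. by move=> /unitarymxP /mulmx1C. Qed.

Lemma spectral_mx1 P : P \is unitarymx -> spectral_mx P (const_mx 1) = 1%:M.
Proof.
move=> hP; rewrite /spectral_mx map_const_mx rmorph1 diag_const_mx mulmx1.
exact: unitarymxKC.
Qed.

Lemma spectral_mx_herm P mu : spectral_mx P mu \is hermsymmx.
Proof.
rewrite hermsymmxE /spectral_mx !trmx_mul !map_mxM trmxCK mulmxA.
rewrite tr_diag_mx map_diag_mx -map_mx_comp; apply/eqP; congr (_ *m diag_mx _ *m _).
by apply/rowP => j; rewrite !mxE /= conjC_real.
Qed.

Lemma hermitian_spectral X : X \is hermsymmx ->
  exists P mu, P \is unitarymx /\ X = spectral_mx P mu.
Proof.
move=> hX; have /hermitian_normalmx /orthomx_spectralP XE := hX.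
have hP := spectral_unitarymx X.
have dE : map_mx (real_complex R) (map_mx (@complex.Re R) (spectral_diag X))
    = spectral_diag X.
  apply/rowP => j; rewrite 2!mxE; apply: RRe_real.
  by have /mxOverP := hermitian_spectral_diag_real hX; apply.
exists (spectralmx X), (map_mx (@complex.Re R) (spectral_diag X)).
by split=> //; rewrite /spectral_mx dE -invmx_unitary.
Qed.

Lemma qform_spectral P mu v :
  (v *m spectral_mx P mu *m v^t*) 0 0
  = \sum_i (mu 0 i)%:C * `|(v *m P^t*) 0 i| ^+ 2.
Proof.
have -> : v *m spectral_mx P mu *m v^t* =
    v *m P^t* *m diag_mx (map_mx (real_complex R) mu) *m (v *m P^t*)^t*.
  by rewrite trmx_mul map_mxM trmxCK /spectral_mx !mulmxA.
move: (v *m P^t*) => w; rewrite mul_mx_diag mxE; apply: eq_bigr => i _.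
by rewrite normCK !mxE mulrCA mulrA.
Qed.

Lemma sqnorm_unitary P v : P \is unitarymx ->
  (v *m v^t*) 0 0 = \sum_i `|(v *m P^t*) 0 i| ^+ 2.
Proof.
move=> hP; rewrite -{1}[v]mulmx1 -(spectral_mx1 hP) qform_spectral.
by apply: eq_bigr => i _; rewrite mxE mul1r.
Qed.

Lemma sqnorm_row_unitary P i : P \is unitarymx -> (row i P *m (row i P)^t*) 0 0 = 1.
Proof.
move=> /unitarymxP /matrixP /(_ i i); rewrite !mxE eqxx => PE.
by rewrite -[RHS]PE; apply: eq_bigr => j _; rewrite !mxE.
Qed.

Lemma row_spectral_mx P mu i : P \is unitarymx ->
  row i P *m spectral_mx P mu = (mu 0 i)%:C *: row i P.
Proof.
move=> /unitarymxP hP; rewrite -row_mul /spectral_mx !mulmxA hP mul1mx mul_diag_mx.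
by apply/rowP => j; rewrite !mxE.
Qed.

Lemma mxtrace_spectral P mu X :
  \tr (spectral_mx P mu *m X)
  = \sum_i (mu 0 i)%:C * (row i P *m X *m (row i P)^t*) 0 0.
Proof.
rewrite /spectral_mx -!mulmxA mxtrace_mulC -!mulmxA mul_diag_mx /mxtrace.
apply: eq_bigr => i _; rewrite mxE; congr (_ * _); first by rewrite mxE.
by rewrite mulmxA -row_mul !mxE; apply: eq_bigr => j _; rewrite !mxE.
Qed.

Lemma spectral_mx_psd P mu : (forall i, 0 <= mu 0 i) -> psd (spectral_mx P mu).
Proof.
move=> mu0; split=> [|v]; first exact: spectral_mx_herm.
rewrite qform_spectral sumr_ge0 // => i _.
by rewrite mulr_ge0 ?exprn_ge0 // lecR.
Qed.

Lemma psd_spectral X : psd X ->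
  exists P mu, [/\ P \is unitarymx, X = spectral_mx P mu & forall i, 0 <= mu 0 i].
Proof.
case=> /hermitian_spectral[P [mu [hP ->]]] X0; exists P, mu; split=> // i.
have := X0 (row i P); rewrite row_spectral_mx // -scalemxAl mxE.
by rewrite sqnorm_row_unitary // mulr1 lecR.
Qed.

End SpectralMatrices.

(** * Largest eigenvalue, spectral range and differences of density operators *)

Section LargestEigenvalue.
Variables (R : realType) (d : nat).
Local Notation C := R[i].
Local Notation M := 'M[C]_d.+1.
Implicit Types (P X Y : M) (mu nu : 'rV[R]_d.+1) (v : 'rV[C]_d.+1).

(** The dimension [d.+1] is positive, so for Hermitian [X] this supremum is attained. *)
Definition lmax X : R := sup (real_eigenvalues X).

(** Rayleigh's principle: one direction diagonalizes the form, the other tests it on an eigenvector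
    for [lmax X]. It makes sublinearity of [lmax] an addition of quadratic forms. *)
Lemma lmax_leP X c : X \is hermsymmx ->
  lmax X <= c <-> forall v, (v *m X *m v^t*) 0 0 <= c%:C * (v *m v^t*) 0 0.
Proof.
move=> hX; have [[eX uX] _] := real_eigenvalues_extrema hX; split=> [Xc v|h].
  have [P [mu [hP XE]]] := hermitian_spectral hX.
  rewrite XE qform_spectral (sqnorm_unitary v hP) mulr_sumr.
  apply: ler_sum => i _; rewrite ler_wpM2r ?exprn_ge0 // lecR.
  apply: le_trans Xc; apply: uX; apply/eigenvalueP; exists (row i P).
    by rewrite XE row_spectral_mx.
  apply: contraTneq (ltr01 : 0 < 1 :> C) => r0.
  by rewrite -(sqnorm_row_unitary i hP) r0 mul0mx mxE ltxx.
have /eigenvalueP[v vX v0] := eX; have := h v.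
rewrite vX -scalemxAl mxE -/(lmax X) ler_pM2r ?lecR // -dotmxE.
by rewrite dnorm_gt0.
Qed.

Lemma hermB X Y : X \is hermsymmx -> Y \is hermsymmx -> X - Y \is hermsymmx.
Proof. by move=> hX hY; rewrite hermD ?hermN. Qed.

Lemma lmaxD X Y : X \is hermsymmx -> Y \is hermsymmx ->
  lmax (X + Y) <= lmax X + lmax Y.
Proof.
move=> hX hY; apply/lmax_leP => [|v]; first exact: hermD.
rewrite mulmxDr mulmxDl mxE rmorphD mulrDl lerD //.
  by have /lmax_leP := lexx (lmax X); apply.
by have /lmax_leP := lexx (lmax Y); apply.
Qed.

Lemma lmaxZ_le (a : R) X : 0 <= a -> X \is hermsymmx ->
  lmax (a%:C *: X) <= a * lmax X.
Proof.
move=> a0 hX; apply/lmax_leP => [|v]; first exact: hermZ.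
rewrite -scalemxAr -scalemxAl mxE rmorphM -mulrA ler_wpM2l ?lecR //.
by have /lmax_leP := lexx (lmax X); apply.
Qed.

Lemma lmax_spectral_le P mu c : P \is unitarymx ->
  (forall i, mu 0 i <= c) -> lmax (spectral_mx P mu) <= c.
Proof.
move=> hP muc; apply/lmax_leP => [|v]; first exact: spectral_mx_herm.
rewrite qform_spectral (sqnorm_unitary v hP) mulr_sumr.
by apply: ler_sum => i _; rewrite ler_wpM2r ?exprn_ge0 // lecR.
Qed.

(** In an eigenbasis of [rho] the trace is a convex combination of Rayleigh quotients of [X]. *)
Lemma density_trace_le (rho X : M) : psd rho -> \tr rho = 1 -> X \is hermsymmx ->
  \tr (rho *m X) <= (lmax X)%:C.
Proof.
move=> /psd_spectral[P [mu [hP -> mu0]]] + hX.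
rewrite -{1}[spectral_mx P mu]mulmx1 !mxtrace_spectral => tr1.
rewrite -[leRHS]mulr1 -tr1 mulr_sumr; apply: ler_sum => i _.
rewrite mulrCA ler_wpM2l ?lecR // mulmx1.
by have /lmax_leP := lexx (lmax X); apply.
Qed.

(** Negation exchanges the two ends of the spectrum. This form reduces the seminorm laws to those of
    [lmax]. *)
Lemma spectral_rangeE X : spectral_range X = lmax X + lmax (- X).
Proof.
rewrite /spectral_range /inf opprK /lmax; congr (_ + sup _).
apply/seteqP; split=> x /=.
  case=> y /eigenvalueP[v vX v0] <-; apply/eigenvalueP; exists v => //.
  by rewrite mulmxN vX rmorphN scaleNr.
case/eigenvalueP=> v vX v0; exists (- x); last by rewrite opprK.
apply/eigenvalueP; exists v => //.
by rewrite rmorphN scaleNr -vX mulmxN opprK.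
Qed.

Lemma spectral_rangeD X Y : X \is hermsymmx -> Y \is hermsymmx ->
  spectral_range (X + Y) <= spectral_range X + spectral_range Y.
Proof.
move=> hX hY; rewrite !spectral_rangeE opprD.
by rewrite addrACA lerD ?lmaxD ?hermN.
Qed.

Lemma spectral_rangeZ_le (a : R) X : 0 <= a -> X \is hermsymmx ->
  spectral_range (a%:C *: X) <= a * spectral_range X.
Proof.
move=> a0 hX; rewrite !spectral_rangeE -scalerN mulrDr.
by rewrite lerD ?lmaxZ_le ?hermN.
Qed.

Lemma spectral_rangeN X : spectral_range (- X) = spectral_range X.
Proof. by rewrite !spectral_rangeE [- - X]opprK; apply: addrC. Qed.

Lemma density_diff_trace_le (rho0 rho1 X : M) :
  psd rho0 -> \tr rho0 = 1 -> psd rho1 -> \tr rho1 = 1 -> X \is hermsymmx ->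
  \tr ((rho0 - rho1) *m X) <= (spectral_range X)%:C.
Proof.
move=> p0 t0 p1 t1 hX; rewrite spectral_rangeE mulmxBl raddfB rmorphD /=.
by rewrite -[- \tr _]raddfN -mulmxN lerD ?density_trace_le ?hermN.
Qed.

(* D has trace 0 because the identity has
   spectral range 0, and testing D against the projection onto its positive part
   shows that this part has trace at most 1; the missing weight is made up with
   a multiple of the identity. *)
Lemma density_diff_of_trace_le (D : M) : D \is hermsymmx ->
  (forall X, X \is hermsymmx -> \tr (D *m X) <= (spectral_range X)%:C) ->
  exists rho0 rho1, [/\ psd rho0 /\ psd rho1, \tr rho0 = 1 /\ \tr rho1 = 1
                      & D = rho0 - rho1].
Proof.
move=> /hermitian_spectral[P [mu [hP ->]]] h.
have trE nu : \tr (spectral_mx P nu) = (\sum_i nu 0 i)%:C.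
  rewrite -[spectral_mx P nu]mulmx1 mxtrace_spectral rmorph_sum.
  by apply: eq_bigr => i _; rewrite mulmx1 sqnorm_row_unitary // mulr1.
have trM nu ka :
    \tr (spectral_mx P nu *m spectral_mx P ka) = (\sum_i nu 0 i * ka 0 i)%:C.
  rewrite mxtrace_spectral rmorph_sum; apply: eq_bigr => i _.
  by rewrite row_spectral_mx // -scalemxAl mxE sqnorm_row_unitary // mulr1 rmorphM.
(* Only test operators diagonal in the eigenbasis of D are needed, which turns the hypothesis into
   inequalities between real vectors. *)
have hle nu (a b : R) : (forall i, nu 0 i <= a) -> (forall i, - nu 0 i <= b) ->
    \sum_i mu 0 i * nu 0 i <= a + b.
  move=> nua nub; have := h _ (spectral_mx_herm P nu); rewrite trM lecR.
  move/le_trans; apply; rewrite spectral_rangeE spectral_mxN.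
  by rewrite lerD ?lmax_spectral_le // => i; rewrite mxE.
have sum0 : \sum_i mu 0 i = 0.
  apply/eqP; rewrite eq_le; apply/andP; split.
    have := hle (const_mx 1) 1 (-1); rewrite subrr => le0.
    apply: le_trans (le0 _ _) => [|i|i]; rewrite ?mxE //.
    by apply: ler_sum => i _; rewrite mxE mulr1.
  rewrite -oppr_le0 -sumrN.
  have := hle (const_mx (-1)) (-1) 1; rewrite addNr => le0.
  apply: le_trans (le0 _ _) => [|i|i]; rewrite ?mxE ?opprK //.
  by apply: ler_sum => i _; rewrite mxE mulrN1.
pose pos : 'rV[R]_d.+1 := \row_i Num.max (mu 0 i) 0.
pose c := \sum_i pos 0 i.
have c1 : c <= 1.
  pose nu : 'rV[R]_d.+1 := \row_i (if 0 < mu 0 i then 1 else 0).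
  have -> : c = \sum_i mu 0 i * nu 0 i.
    apply: eq_bigr => i _; rewrite !mxE.
    by have [m0|m0] := ltP 0 (mu 0 i); rewrite ?mulr1 ?mulr0.
  rewrite -[1]addr0; apply: hle => i; rewrite mxE; case: ifP => _;
    by rewrite ?oppr0 ?lerN10 ?ler01.
pose w : R := (1 - c) / d.+1%:R.
have w0 : 0 <= w by rewrite divr_ge0 ?subr_ge0.
have sumw : \sum_(i < d.+1) w = 1 - c.
  by rewrite sumr_const card_ord -mulr_natr divfK ?pnatr_eq0.
(* The vector [pos - mu] is the negative part; its sum is also [c] since [mu] sums to 0, so the same
   [w] completes both traces to 1. *)
exists (spectral_mx P (pos + const_mx w)), (spectral_mx P (pos - mu + const_mx w)).
split.
- split; apply: spectral_mx_psd => i; rewrite !mxE.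
    by rewrite addr_ge0 // le_max lexx orbT.
  by rewrite addr_ge0 // subr_ge0 le_max lexx.
- rewrite !trE; split; rewrite -[1](rmorph1 (real_complex R)); congr (_ %:C).
    transitivity (c + \sum_(i < d.+1) w); last by rewrite sumw addrC subrK.
    by rewrite -big_split; apply: eq_bigr => i _; rewrite [LHS]mxE [const_mx _ _ _]mxE.
  transitivity (c - \sum_i mu 0 i + \sum_(i < d.+1) w).
    rewrite -sumrN -!big_split; apply: eq_bigr => i _.
    by rewrite [LHS]mxE [const_mx _ _ _]mxE [(pos - mu) _ _]mxE [(- mu) _ _]mxE.
  by rewrite sum0 subr0 sumw addrC subrK.
- by rewrite spectral_mxB opprD addrACA subrr addr0 opprB addrC subrK.
Qed.

End LargestEigenvalue.

(** * Real coordinates on Hermitian matrices *)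

(* Hermitian matrices form a vector space over the reals, but not a type with
   such a structure; herm_mx identifies them with the real square matrices. *)
Section RealCoordinates.
Variables (R : realType) (n : nat).
Local Notation C := R[i].
Implicit Types (A F : 'M[R]_n) (X Y : 'M[C]_n).

Definition herm_mx A : 'M[C]_n :=
  \matrix_(i, j) Complex ((A i j + A j i) / 2) ((A i j - A j i) / 2).

(** For Hermitian [X] the real part is symmetric and the imaginary part antisymmetric, so their sum
    determines both. *)
Definition real_mx X : 'M[R]_n :=
  \matrix_(i, j) (complex.Re (X i j) + complex.Im (X i j)).

Lemma herm_mx_herm A : herm_mx A \is hermsymmx.
Proof.
rewrite hermsymmxE; apply/eqP/matrixP => i j; rewrite !mxE.
by apply/eqP; rewrite eq_complex /=; apply/andP; split; apply/eqP; field.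
Qed.

Lemma herm_mxP X : X \is hermsymmx -> forall i j,
  complex.Re (X j i) = complex.Re (X i j) /\ complex.Im (X j i) = - complex.Im (X i j).
Proof.
rewrite hermsymmxE => /eqP hX i j; rewrite {1 3}hX !mxE.
by case: (X i j).
Qed.

Lemma real_mxK X : X \is hermsymmx -> herm_mx (real_mx X) = X.
Proof.
move=> hX; apply/matrixP => i j; rewrite !mxE; have [-> ->] := herm_mxP hX i j.
by case: (X i j) => a b /=; congr Complex; field.
Qed.

Lemma herm_mxD A F : herm_mx (A + F) = herm_mx A + herm_mx F.
Proof.
apply/matrixP => i j; rewrite !mxE; apply/eqP; rewrite eq_complex /=.
by apply/andP; split; apply/eqP; field.
Qed.

Lemma herm_mxZ (a : R) A : herm_mx (a *: A) = a%:C *: herm_mx A.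
Proof.
apply/matrixP => i j; rewrite !mxE; apply/eqP; rewrite eq_complex /=.
by apply/andP; split; apply/eqP; field.
Qed.

Lemma herm_mxN A : herm_mx (- A) = - herm_mx A.
Proof. by rewrite -scaleN1r herm_mxZ rmorphN scaleN1r. Qed.

Lemma herm_mxB A F : herm_mx (A - F) = herm_mx A - herm_mx F.
Proof. by rewrite herm_mxD herm_mxN. Qed.

Lemma herm_mx_eq0 A : herm_mx A = 0 -> A = 0.
Proof.
move=> /matrixP A0; apply/matrixP => i j; have := A0 i j; rewrite !mxE.
by case=> ? ?; lra.
Qed.

(** The coordinates carry the Hilbert-Schmidt product to the entrywise one, so every real functional
    on them is a trace. *)
Lemma mxtrace_herm_mx F X : X \is hermsymmx ->
  \tr (herm_mx F *m X) = (\sum_i \sum_j F i j * real_mx X i j)%:C.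
Proof.
move=> hX; rewrite (herm_trace_real (herm_mx_herm F) hX); congr (_ %:C).
pose T i j := F i j * real_mx X i j.
(* Each entry contributes only the symmetrization of [T]; exchanging the sums then removes it. *)
transitivity (\sum_i \sum_j (T i j + T j i) / 2).
  rewrite /mxtrace (raddf_sum (@complex.Re R)); apply: eq_bigr => i _.
  rewrite mxE (raddf_sum (@complex.Re R)); apply: eq_bigr => j _.
  rewrite /T !mxE; have [-> ->] := herm_mxP hX i j.
  have := herm_mxP hX i j; case: (X j i) => a b /= [-> ->]; by field.
transitivity ((\sum_i \sum_j T i j + \sum_i \sum_j T j i) / 2).
  rewrite -big_split mulr_suml; apply: eq_bigr => i _.
  by rewrite -big_split mulr_suml.
by rewrite [X in _ + X]exchange_big -mulr2n -[X in X / _]mulr_natr mulfK ?pnatr_eq0.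
Qed.

Lemma span_real_mx (B : seq 'M[C]_n) A : all (fun X => X \is hermsymmx) B ->
  A \in <<map real_mx B>>%VS <-> real_span B (herm_mx A).
Proof.
elim: B A => [|b B IH] A /=.
  rewrite span_nil memv0 real_span_nil => _; split=> [/eqP ->|/herm_mx_eq0 -> //].
  by rewrite -(scale0r 0) herm_mxZ scale0r.
case/andP=> hb hB; rewrite span_cons real_span_cons; split.
  case/memv_addP=> _ /vlineP[x ->] [A' A'B ->]; exists x.
  by rewrite herm_mxD herm_mxZ real_mxK // addrC addKr; apply/IH.
case=> x; rewrite -{1}(real_mxK hb) -herm_mxZ -herm_mxB => /IH h.
by rewrite -[A](subrK (x *: real_mx b)) addrC memv_add ?memvZ ?memv_line ?h.
Qed.

End RealCoordinates.

(** * Duality for the spectral-range distance to a real span *)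

Section OperatorDuality.
Variables (R : realType) (d : nat).
Local Notation C := R[i].
Local Notation M := 'M[C]_d.+1.
Implicit Types (X S : M) (B : seq M).

Lemma spectral_range_seminorm :
  seminorm (fun A : 'M[R]_d.+1 => spectral_range (herm_mx A)).
Proof.
split; last by move=> A; rewrite herm_mxN spectral_rangeN.
apply: sublinear_of_le => [A F|a A a0].
  by rewrite herm_mxD spectral_rangeD ?herm_mx_herm.
by rewrite herm_mxZ spectral_rangeZ_le ?herm_mx_herm.
Qed.

Lemma spectral_range_ge0 X : X \is hermsymmx -> 0 <= spectral_range X.
Proof.
by move=> hX; rewrite -(real_mxK hX) (seminorm_ge0 _ spectral_range_seminorm).
Qed.

Lemma spectral_range0 : spectral_range (0 : M) = 0.
Proof.
have := sublinear0 spectral_range_seminorm.1.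
by rewrite -(scale0r 0) herm_mxZ scale0r.
Qed.

Theorem spectral_range_duality B X :
  all (fun A => A \is hermsymmx) B -> X \is hermsymmx ->
  exists S0, [/\ real_span B S0,
    forall S, real_span B S -> spectral_range (X - S0) <= spectral_range (X - S)
    & exists rho0 rho1, [/\ psd rho0 /\ psd rho1, \tr rho0 = 1 /\ \tr rho1 = 1,
        forall S, real_span B S -> \tr ((rho0 - rho1) *m S) = 0
        & \tr ((rho0 - rho1) *m X) = (spectral_range (X - S0))%:C]].
Proof.
move=> hB hX.
have [A [AB Amin [f [fle fB fX]]]] :=
  seminorm_duality (map (@real_mx _ _) B) (real_mx X) spectral_range_seminorm.
move: Amin fX; rewrite herm_mxB real_mxK // => Amin fX.
exists (herm_mx A); split; first exact/span_real_mx.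
  move=> S SB; have hS := real_span_herm hB SB.
  have := Amin (real_mx S); rewrite herm_mxB (real_mxK hX) (real_mxK hS); apply.
  by apply/span_real_mx => //; rewrite real_mxK.
(* [F] represents [f] entrywise, so [f] is the trace against [herm_mx F]; domination by the spectral
   range splits this operator into density operators. *)
pose F : 'M[R]_d.+1 := \matrix_(i, j) f (delta_mx i j).
have fE G : f G = \sum_i \sum_j F i j * G i j.
  rewrite {1}[G]matrix_sum_delta linear_sum; apply: eq_bigr => i _.
  by rewrite linear_sum; apply: eq_bigr => j _; rewrite linearZ mxE mulrC.
have trE S : S \is hermsymmx -> \tr (herm_mx F *m S) = (f (real_mx S))%:C.
  by move=> hS; rewrite mxtrace_herm_mx // fE.
have [|rho0 [rho1 [rho_psd rho_tr DE]]] := density_diff_of_trace_le (herm_mx_herm F).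
  by move=> S hS; rewrite trE // lecR -{2}(real_mxK hS).
exists rho0, rho1; rewrite -DE; split=> // [S SB|]; last by rewrite trE // fX.
have hS := real_span_herm hB SB.
by rewrite trE // fB //; apply/span_real_mx => //; rewrite real_mxK.
Qed.

Lemma mem_real_span B b : b \in B -> real_span B b.
Proof.
elim: B => // a B IH; rewrite in_cons real_span_cons => /predU1P[->|/IH bB].
  by exists 1; rewrite scale1r subrr; exact: real_span0.
by exists 0; rewrite scale0r subr0.
Qed.

Lemma real_span_ind B (K : M -> Prop) : K 0 ->
  (forall x b S, b \in B -> K S -> K (x%:C *: b + S)) ->
  forall S, real_span B S -> K S.
Proof.
move=> K0 KS _ [c ->]; elim/big_rec: _ => // k S _; apply: KS.
by rewrite mem_nth.
Qed.

End OperatorDuality.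

(** * Linearity in the parameter vector *)

Section Functional.
Variables (R : realType) (d m : nat).
Local Notation M := 'M[R[i]]_d.
Implicit Types (g : 'I_m -> M) (alpha beta v w : 'rV[R]_m).

Lemma rdotD alpha v w : rdot alpha (v + w) = rdot alpha v + rdot alpha w.
Proof. by rewrite -big_split; apply: eq_bigr => j _; rewrite mxE mulrDr. Qed.

Lemma rdotZ alpha (a : R) v : rdot alpha (a *: v) = a * rdot alpha v.
Proof. by rewrite /rdot mulr_sumr; apply: eq_bigr => j _; rewrite mxE mulrCA. Qed.

Lemma rdotB alpha v w : rdot alpha (v - w) = rdot alpha v - rdot alpha w.
Proof. by rewrite rdotD -scaleN1r rdotZ mulN1r. Qed.

Lemma rdot0 alpha : rdot alpha 0 = 0.
Proof. by rewrite -(subrr 0) rdotB subrr. Qed.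

Lemma rdot_delta alpha j : rdot alpha (delta_mx 0 j) = alpha 0 j.
Proof.
rewrite /rdot (bigD1 j) //= mxE !eqxx mulr1 big1 ?addr0 // => k kj.
by rewrite mxE (negPf kj) mulr0.
Qed.

Lemma normalized_exists alpha : alpha != 0 -> exists beta, normalized alpha beta.
Proof.
move=> /rV0Pn[j aj]; exists ((alpha 0 j)^-1 *: delta_mx 0 j).
by rewrite /normalized /= rdotZ rdot_delta mulVf.
Qed.

Lemma combinationD g v w : combination g (v + w) = combination g v + combination g w.
Proof.
by rewrite -big_split; apply: eq_bigr => j _; rewrite mxE rmorphD scalerDl.
Qed.

Lemma combinationZ g (a : R) v : combination g (a *: v) = a%:C *: combination g v.
Proof.
rewrite /combination scaler_sumr; apply: eq_bigr => j _.
by rewrite mxE rmorphM scalerA.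
Qed.

Lemma combinationB g v w : combination g (v - w) = combination g v - combination g w.
Proof. by rewrite combinationD -scaleN1r combinationZ rmorphN scaleN1r. Qed.

Lemma combination0 g : combination g 0 = 0.
Proof. by rewrite -(subrr 0) combinationB subrr. Qed.

Lemma combination_delta g j : combination g (delta_mx 0 j) = g j.
Proof.
rewrite /combination (bigD1 j) //= mxE !eqxx scale1r big1 ?addr0 // => k kj.
by rewrite mxE (negPf kj) scale0r.
Qed.

Lemma combination_herm g v :
  (forall j, g j \is hermsymmx) -> combination g v \is hermsymmx.
Proof.
move=> hg; apply: (big_ind (fun X : M => X \is hermsymmx)).
- exact: herm0.
- by move=> X Y; exact: hermD.
- by move=> j _; exact: hermZ.
Qed.

End Functional.

(** * The dual program and the Lindblad distance *)

Section Lindblad.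
Variables (R : realType) (d m r : nat).
Local Notation M := 'M[R[i]]_d.+1.
Implicit Types (g : 'I_m -> M) (L : 'I_r -> M) (alpha beta v : 'rV[R]_m).

Lemma lindblad_dist_min L X : X \is hermsymmx ->
  is_min [set spectral_range (X - S) | S in lindblad_span L] (lindblad_dist L X).
Proof.
move=> hX; have [S0 [S0L S0min _]] :=
  spectral_range_duality (lindblad_generators_herm L) hX.
have hmin : is_min [set spectral_range (X - S) | S in lindblad_span L]
    (spectral_range (X - S0)).
  by split=> [|_ [S SL <-]]; [exists S0 | exact: S0min].
by rewrite /lindblad_dist (is_min_inf hmin).
Qed.

(* For normalized [beta] and [beta0], the differences [combination g beta - S]
   with [S] in the Lindblad span are exactly the translates of
   [combination g beta0] by the real span of these generators. *)
Definition dual_generators g L alpha beta0 : seq M :=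
  lindblad_generators L
  ++ [seq g j - (alpha 0 j)%:C *: combination g beta0 | j : 'I_m].

Lemma dual_generators_herm g L alpha beta0 : (forall j, g j \is hermsymmx) ->
  all (fun X => X \is hermsymmx) (dual_generators g L alpha beta0).
Proof.
move=> hg; rewrite all_cat lindblad_generators_herm /=.
by apply/allP => _ /mapP[j _ ->]; rewrite hermB ?hermZ ?combination_herm.
Qed.

(** Each added generator is the combination at [delta_mx 0 j - alpha 0 j *: beta0], a vector
    annihilated by [alpha]. Conversely, if [rdot alpha v = 0], the [beta0] terms cancel in the sum
    weighted by [v]. *)
Lemma dual_spanP g L alpha beta0 T : normalized alpha beta0 ->
  real_span (dual_generators g L alpha beta0) T <->
  exists2 v, rdot alpha v = 0 & lindblad_span L (T - combination g v).
Proof.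
move=> b01; split; first move: T; last case=> v v0 LT.
  apply: real_span_ind => [|x b T]; last rewrite mem_cat => bB [v v0 LT].
    exists 0; first exact: rdot0.
    by rewrite combination0 subr0; exact: real_span0.
  case/orP: bB => [bL|/mapP[j _ ->]].
    exists v => //; rewrite -addrA; apply: real_spanD LT.
    by apply: real_spanZ; exact: mem_real_span.
  exists (x *: (delta_mx 0 j - alpha 0 j *: beta0) + v).
    by rewrite rdotD v0 addr0 rdotZ rdotB rdot_delta rdotZ b01 mulr1 subrr mulr0.
  rewrite combinationD combinationZ combinationB combination_delta combinationZ.
  by rewrite opprD addrACA subrr add0r.
have sub S : lindblad_span L S -> real_span (dual_generators g L alpha beta0) S.
  apply: real_span_ind => [|x b S' bL]; first exact: real_span0.
  apply: real_spanD; apply: real_spanZ; apply: mem_real_span.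
  by rewrite mem_cat bL.
rewrite -[T](subrK (combination g v)); apply: real_spanD; first exact: sub.
have -> : combination g v =
    \sum_j (v 0 j)%:C *: (g j - (alpha 0 j)%:C *: combination g beta0).
  transitivity (combination g v - (rdot alpha v)%:C *: combination g beta0).
    by rewrite v0 scale0r subr0.
  rewrite rmorph_sum scaler_suml -sumrB; apply: eq_bigr => j _.
  by rewrite scalerBr scalerA mulrC rmorphM.
apply: (big_ind (real_span (dual_generators g L alpha beta0))).
- exact: real_span0.
- by move=> S S'; exact: real_spanD.
- move=> j _; apply/real_spanZ/mem_real_span; rewrite mem_cat.
  by apply/orP; right; apply/mapP; exists j; rewrite ?mem_enum.
Qed.

Lemma zeta_star_duality g L alpha : (forall j, g j \is hermsymmx) -> alpha != 0 ->
  is_min [set lindblad_dist L (combination g beta) | beta in normalized alpha]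
         (zeta_star g L alpha)
  /\ is_max (dual_values g L alpha) (zeta_star g L alpha).
Proof.
move=> hg /normalized_exists[b0 nb0]; have hG v := combination_herm v hg.
have [T0 [T0W T0min [rho0 [rho1 [rho_psd rho_tr rhoW rhoG]]]]] :=
  spectral_range_duality (dual_generators_herm L alpha b0 hg) (hG b0).
(* The nearest point splits as [T0 = S0 + combination g v0], so [b0 - v0] and [S0] are the primal
   optimizers. *)
have /(dual_spanP g L T0 nb0)[v0 av0 S0L] := T0W.
set S0 := T0 - combination g v0 in S0L; set z := spectral_range _ in T0min rhoG.
have nb : normalized alpha (b0 - v0) by rewrite /normalized /= rdotB av0 subr0.
have zE : spectral_range (combination g (b0 - v0) - S0) = z.
  by rewrite combinationB /S0 opprB addrA subrK.
clearbody z S0.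
have zle b S : normalized alpha b -> lindblad_span L S ->
    z <= spectral_range (combination g b - S).
  (* Replacing [b] by [b0] shifts the generator by a combination at [b0 - b], which [alpha]
     annihilates; the shifted point still competes with [T0]. *)
  move=> nbb SL; have -> : combination g b - S =
      combination g b0 - (S + combination g (b0 - b)).
    by rewrite combinationB opprD opprB [RHS]addrCA subrKC addrC.
  apply: T0min.
  apply: (dual_spanP g L _ nb0).2.
  exists (b0 - b); last by rewrite addrK.
  by rewrite rdotB nb0 nbb subrr.
have zmin : is_min
    [set lindblad_dist L (combination g b) | b in normalized alpha] z.
  split=> [|_ [b nbb <-]]; last by have [[S SL <-] _] := lindblad_dist_min L (hG b); exact: zle.
  exists (b0 - v0); first exact: nb.
  have [[S SL E] lbS] := lindblad_dist_min L (hG (b0 - v0)).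
  apply/le_anti/andP; split; last by rewrite -E; exact: zle.
  rewrite -zE; apply: lbS; by exists S0.
rewrite /zeta_star (is_min_inf zmin); split=> //; split.
  exists rho0, rho1; split=> // [j|S SL].
    (* The trace against [combination g b0] is [z], so annihilating this generator is exactly the
       dual constraint for [g j]. *)
    have := rhoW (g j - (alpha 0 j)%:C *: combination g b0).
    rewrite mulmxBr raddfB /= -scalemxAr mxtraceZ rhoG mulrC -rmorphM => /(_ _)/eqP.
    rewrite subr_eq0 => h; apply/eqP/h/mem_real_span; rewrite mem_cat.
    by apply/orP; right; apply/mapP; exists j; rewrite ?mem_enum.
  apply: rhoW; apply: (dual_spanP g L _ nb0).2; exists 0; first exact: rdot0.
  by rewrite combination0 subr0.
(* Weak duality: pairing any feasible difference with the optimal [combination g (b0 - v0) - S0]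
   gives [zeta], at most its spectral range [z]. *)
move=> zeta [s0 [s1 [sg sL [p0 p1] [t0 t1]]]].
rewrite -lecR -zE.
apply: le_trans (density_diff_trace_le p0 t0 p1 t1 _); last first.
  by rewrite hermB // (real_span_herm (lindblad_generators_herm L) S0L).
rewrite mulmxBr raddfB /= (sL _ S0L) subr0 /combination mulmx_sumr raddf_sum /=.
under eq_bigr do rewrite -scalemxAr mxtraceZ sg -rmorphM mulrCA.
rewrite -rmorph_sum -mulr_sumr lecR.
by have -> : \sum_j (b0 - v0) 0 j * alpha 0 j = 1; rewrite ?mulr1 //; rewrite -[RHS]nb;
  apply: eq_bigr => j _; rewrite mulrC.
Qed.

Lemma lindblad_dist_ge0 L X : X \is hermsymmx -> 0 <= lindblad_dist L X.
Proof.
move=> hX; have [[S SL <-] _] := lindblad_dist_min L hX.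
by rewrite spectral_range_ge0 // hermB // (real_span_herm (lindblad_generators_herm L) SL).
Qed.

Lemma lindblad_dist_span L X : X \is hermsymmx -> lindblad_span L X ->
  lindblad_dist L X = 0.
Proof.
move=> hX XL; apply/le_anti; rewrite lindblad_dist_ge0 // andbT.
have [_] := lindblad_dist_min L hX; apply.
by exists X; rewrite ?subrr ?spectral_range0.
Qed.

(** It places [combination g v] in the Lindblad span whenever [v] is in the kernel of the projected
    generators. *)
Lemma combination_perp_span g L v : (forall j, g j \is hermsymmx) ->
  lindblad_span L
    (combination g v
     - combination (fun j => perp_part (lindblad_span L) (g j)) v).
Proof.
move=> hg; rewrite -sumrB; apply: (big_ind (lindblad_span L)).
- exact: real_span0.
- by move=> S S'; exact: real_spanD.
move=> j _; rewrite -scalerBr; apply: real_spanZ.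
by have [] := perp_partP (lindblad_generators_herm L) (hg j).
Qed.

End Lindblad.

Theorem mainTheorem2 (R : realType) (d m r : nat)
    (g : 'I_m -> 'M[R[i]]_d.+1) (L : 'I_r -> 'M[R[i]]_d.+1)
    (alpha : 'rV[R]_m)
    (g_herm : forall j, g j \is hermsymmx) (alpha_neq0 : alpha != 0) :
  [/\ (forall beta, normalized alpha beta ->
         is_min [set spectral_range (combination g beta - S)
                | S in lindblad_span L]
                (lindblad_dist L (combination g beta)))
      /\ is_min [set lindblad_dist L (combination g beta)
                | beta in normalized alpha]
                (zeta_star g L alpha),
      is_max (dual_values g L alpha) (zeta_star g L alpha),
      forall t : R, 0 <= t ->
        is_min [set qfi_bound L t (combination g beta)
               | beta in normalized alpha]
               (F_opt g L alpha t)
        /\ (functional_HNLS g L alpha ->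
            F_opt g L alpha t = t ^+ 2 * zeta_star g L alpha ^+ 2)
    & ~ functional_HNLS g L alpha -> zeta_star g L alpha = 0].
Proof.
have hG v := combination_herm v g_herm.
have [zmin zmax] := zeta_star_duality L g_herm alpha_neq0.
have [[b nb bz] zlb] := zmin.
have z0 : 0 <= zeta_star g L alpha by rewrite -bz lindblad_dist_ge0.
split=> // [|t _|/existsNP[v /not_implyP[Gv0 /eqP av0]]].
- by split=> // beta _; exact: lindblad_dist_min.
(* Squaring is monotone on the nonnegative distances, so the minimizer [b] for [zeta_star] also
   minimizes the bound. *)
- have Fmin : is_min
      [set qfi_bound L t (combination g beta) | beta in normalized alpha]
      (t ^+ 2 * zeta_star g L alpha ^+ 2).
    split=> [|_ [c nc <-]]; first by exists b => //; rewrite /qfi_bound bz.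
    rewrite ler_wpM2l ?sqr_ge0 // ler_sqr ?nnegrE ?lindblad_dist_ge0 //.
    by apply: zlb; exists c.
  by rewrite /F_opt (is_min_inf Fmin).
- apply/le_anti; rewrite z0 andbT.
  (* The vector [v] violating HNLS, rescaled to be normalized, has its generator inside the Lindblad
     span, at distance 0. *)
  apply: zlb; exists ((rdot alpha v)^-1 *: v).
    by rewrite /normalized /= rdotZ mulVf.
  apply: lindblad_dist_span => //; rewrite combinationZ; apply: real_spanZ.
  by have := combination_perp_span L v g_herm; rewrite Gv0 subr0.
Qed.
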